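(* Let $f_1,\dots,f_m:\mathbb{R}^d\to\mathbb{R}$, $\varepsilon,\delta\ge0$, $0<M\le+\infty$, $0<\rho\le L<+\infty$, $K\ge2$, $\alpha\in(0,1]$, $\{\boldsymbol\beta^\star_k\}_{k=1}^K\subseteq\mathbb{R}^d$, $\{z^\star_j\}_{j=1}^m\subseteq[K]$, $\{\boldsymbol\theta^\star_j\}\subseteq\mathbb{R}^d$, and suppose there is $S\subseteq[m]$ such that each $f_j$, $j\in S$, is $(\boldsymbol\theta^\star_j,M,\rho,L)$-regular, $\max_{j\in S}\|\boldsymbol\theta^\star_j-\boldsymbol\beta^\star_{z^\star_j}\|_2\le\delta$ and $|S^c|\le\varepsilon m$. Let $\kappa=L/\rho$ and $T(k)=\{j\in[m]:z^\star_j=k\}$. Suppose $\varepsilon\le\frac{\alpha}{6\kappa K^2}$, $\min_k|T(k)|\ge\frac{7\alpha m}{6K}$ and $$\frac{12\kappa K}{\sqrt\alpha}\max_{j\in[m]}\|\nabla f_j(\boldsymbol\theta^\star_j)\|_2<\lambda<\frac\rho6\min\Big\{M,\min_{k\ne l}\|\boldsymbol\beta^\star_k-\boldsymbol\beta^\star_l\|_2\Big\}.$$ Let $(\widehat{\boldsymbol\Theta},\widehat{\boldsymbol B},\widehat{\boldsymbol z})$ minimize $\sum_{j=1}^m[f_j(\boldsymbol\theta_j)+\lambda\|\boldsymbol\beta_{z_j}-\boldsymbol\theta_j\|_2]$ over $\boldsymbol\Theta\in\mathbb{R}^{d\times m}$, $\boldsymbol B\in\mathbb{R}^{d\times K}$,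 $\boldsymbol z\in[K]^m$ subject to $\min_{k\in[K]}|\{j:z_j=k\}|\ge\alpha m/K$. Then for all $j\in S$, $$\|\widehat{\boldsymbol\theta}_j-\boldsymbol\theta^\star_j\|_2\le\frac{\|\sum_{k\in T(z^\star_j)\cap S}\nabla f_k(\boldsymbol\theta^\star_k)\|_2}{\rho|T(z^\star_j)\cap S|}+\min\Big\{\frac{55\kappa^2K\delta}{\sqrt\alpha},\frac{11\lambda}{5\rho}\Big\}+\frac{\lambda|S^c|}{\rho|T(z^\star_j)\cap S|}.$$ Moreover, if $\delta\le\sqrt\alpha\lambda/(100\kappa KL)$, there exists a permutation $\tau$ of $[K]$ such that $\widehat z_j=\tau(z^\star_j)$ and $\widehat{\boldsymbol\theta}_j=\widehat{\boldsymbol\beta}_{\widehat z_j}$ for all $j\in S$.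
   Context: $\boldsymbol\beta_k$ denotes the $k$-th column of $\boldsymbol B$. A function $f:\mathbb{R}^d\to\mathbb{R}$ is $(\boldsymbol\theta^\star,M,\rho,L)$-regular if it is convex and twice differentiable, $\rho\boldsymbol I\preceq\nabla^2f(\boldsymbol\theta)\preceq L\boldsymbol I$ for all $\boldsymbol\theta$ in the closed ball $B(\boldsymbol\theta^\star,M)$, and $\|\nabla f(\boldsymbol\theta^\star)\|_2\le\rho M/2$. The functions $f_j$, $j\in S^c$, are assumed differentiable at $\boldsymbol\theta^\star_j$ (so that the hypothesis makes sense). *)

(* Defs.v *)
From HB Require Import structures.
From mathcomp Require Import all_boot all_order all_algebra.
From mathcomp Require Import all_classical all_reals all_analysis.
Set Implicit Arguments. Unset Strict Implicit. Unset Printing Implicit Defensive.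
Import Order.TTheory GRing.Theory Num.Theory.
Import numFieldNormedType.Exports.
Local Open Scope ring_scope.

Section Defs.
Variable R : realType.
Variable d : nat.

Definition dotv (u v : 'rV[R]_d) : R := \sum_(i < d) u 0 i * v 0 i.
Definition norm2 (u : 'rV[R]_d) : R := Num.sqrt (dotv u u).

Definition ev (i : 'I_d) : 'rV[R]_d := delta_mx 0 i.

Definition grad (f : 'rV[R]_d -> R) (x : 'rV[R]_d) : 'rV[R]_d :=
  \row_i ('D_(ev i) f x).

Definition hess (f : 'rV[R]_d -> R) (x : 'rV[R]_d) : 'M[R]_d :=
  \matrix_(i, j) ('D_(ev j) (fun y => 'D_(ev i) f y) x).

Definition twice_differentiable (f : 'rV[R]_d -> R) : Prop :=
  forall x, differentiable f x /\
    forall i, differentiable (fun y => 'D_(ev i) f y) x.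

Definition convex_fun (f : 'rV[R]_d -> R) : Prop :=
  forall (x y : 'rV[R]_d) (t : R), 0 <= t <= 1 ->
    f (t *: x + (1 - t) *: y) <= t * f x + (1 - t) * f y.

Definition qform (H : 'M[R]_d) (v : 'rV[R]_d) : R :=
  \sum_(i < d) \sum_(j < d) v 0 i * H i j * v 0 j.

Definition regular (f : 'rV[R]_d -> R) (thstar : 'rV[R]_d) (M : \bar R)
    (rho L : R) : Prop :=
  [/\ convex_fun f, twice_differentiable f,
      (forall th, ((norm2 (th - thstar))%:E <= M)%E ->
         forall v, rho * dotv v v <= qform (hess f th) v /\
                   qform (hess f th) v <= L * dotv v v)
    & ((norm2 (grad f thstar))%:E <= (rho / 2)%:E * M)%E].

Definition objective (m K : nat) (f : 'I_m -> 'rV[R]_d -> R) (lam : R)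
    (Th : 'I_m -> 'rV[R]_d) (B : 'I_K -> 'rV[R]_d) (z : 'I_m -> 'I_K) : R :=
  \sum_(j < m) (f j (Th j) + lam * norm2 (B (z j) - Th j)).

Definition feasible (m K : nat) (alpha : R) (z : 'I_m -> 'I_K) : Prop :=
  forall k : 'I_K, alpha * m%:R / K%:R <= #|[set j | z j == k]|%:R.

End Defs.

(* Main.v *)
Require Import Defs.
From HB Require Import structures.
From mathcomp Require Import all_boot all_order all_algebra.
From mathcomp Require Import all_classical all_reals all_analysis.
From mathcomp Require Import fingroup perm.
From mathcomp Require Import ring lra.
Import Order.TTheory GRing.Theory Num.Theory.
Import numFieldNormedType.Exports.
Local Open Scope ring_scope.

(** For [j] in [S], the infimal convolution of [f j] with [lam * norm2] is a
    Huber-type function: it coincides with [f j] where the slope of [f j] is below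
    [lam], and far away it grows linearly. Let [u := lam / L].

    Minimality against a prox subproblem gives
    [norm2 (Thh j - thetastar j) <= 2 * (lam + eta) / rho], where [eta] bounds the
    gradients; this is below [11 * lam / (5 * rho)] and settles the case
    [delta > sqrt alpha * lam / (26 * kappa * K * L)]. Otherwise the clusters are
    recovered exactly:
    - comparing with the centres [betastar], the labels [zstar] on [S], and each
      outlier moved to the true centre nearest to its fitted one, no set of more
      than about [11/12] of the minimal cluster size can have its fitted centres
      farther than [7/20 * u] from the truth, because the linear gain of the
      outliers is dominated by the growth on that set; hence fitted and true
      centres match through a permutation [tau];
    - comparing with the labels [tau (zstar j)] and [Th j = B (z j)] on [S] shows
      that these are the fitted values, since a wrong label costs a multiple of
      [lam ^+ 2 / rho] and slopes near the right centre stay below [lam];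
    - a fitted centre then minimizes the sum of the [f j] of its cluster up to a
      [lam * #|~: S|]-Lipschitz term, and strong convexity bounds its error. *)

(** * Euclidean inner product and norm on row vectors *)

Section Euclidean.
Context {R : realType} {d : nat}.
Implicit Types (u v w : 'rV[R]_d) (a : R).

Lemma dotvC u v : dotv u v = dotv v u.
Proof. by apply: eq_bigr => i _; rewrite mulrC. Qed.

Lemma dotvDl u v w : dotv (u + v) w = dotv u w + dotv v w.
Proof. by rewrite -big_split; apply: eq_bigr => i _ /=; rewrite mxE mulrDl. Qed.

Lemma dotvZl a u v : dotv (a *: u) v = a * dotv u v.
Proof. by rewrite mulr_sumr; apply: eq_bigr => i _; rewrite mxE mulrA. Qed.

Lemma dotvDr u v w : dotv u (v + w) = dotv u v + dotv u w.
Proof. by rewrite dotvC dotvDl !(dotvC u). Qed.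

Lemma dotvZr a u v : dotv u (a *: v) = a * dotv u v.
Proof. by rewrite dotvC dotvZl dotvC. Qed.

Lemma dotv0 u : dotv u 0 = 0.
Proof. by rewrite -(scale0r 0) dotvZr mul0r. Qed.

Lemma dotv_suml (I : finType) (P : pred I) (F : I -> 'rV[R]_d) v :
  dotv (\sum_(i | P i) F i) v = \sum_(i | P i) dotv (F i) v.
Proof.
elim/big_rec2 : _ => [|i x y _ <-]; first by rewrite dotvC dotv0.
by rewrite dotvDl.
Qed.

Lemma dotvv_ge0 u : 0 <= dotv u u.
Proof. by apply: sumr_ge0 => i _; rewrite -expr2 sqr_ge0. Qed.

Lemma dotvv_eq0 u : (dotv u u == 0) = (u == 0).
Proof.
apply/idP/eqP => [|->]; last by rewrite dotv0.
rewrite psumr_eq0 => [/allP h|i _]; last by rewrite -expr2 sqr_ge0.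
apply/rowP => i; rewrite mxE; apply/eqP.
by have := h i (mem_index_enum _); rewrite -expr2 sqrf_eq0.
Qed.

Lemma norm2_ge0 u : 0 <= norm2 u. Proof. exact: sqrtr_ge0. Qed.

Lemma sqr_norm2 u : norm2 u ^+ 2 = dotv u u.
Proof. by rewrite sqr_sqrtr ?dotvv_ge0. Qed.

Lemma norm2_eq0 u : (norm2 u == 0) = (u == 0).
Proof. by rewrite -sqrf_eq0 sqr_norm2 dotvv_eq0. Qed.

Lemma norm2_0 : norm2 (0 : 'rV[R]_d) = 0.
Proof. by apply/eqP; rewrite norm2_eq0. Qed.

Lemma norm2Z a u : norm2 (a *: u) = `|a| * norm2 u.
Proof.
by rewrite /norm2 dotvZl dotvZr mulrA -expr2 sqrtrM ?sqr_ge0// sqrtr_sqr.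
Qed.

Lemma norm2N u : norm2 (- u) = norm2 u.
Proof. by rewrite -scaleN1r norm2Z normrN1 mul1r. Qed.

Lemma dist2C u v : norm2 (u - v) = norm2 (v - u).
Proof. by rewrite -norm2N opprB. Qed.

Lemma le_dotv_norm2 u v : dotv u v <= norm2 u * norm2 v.
Proof.
have [->|v0] := eqVneq v 0; first by rewrite dotv0 norm2_0 mulr0.
have c0 : 0 < dotv v v by rewrite lt_def dotvv_eq0 v0 dotvv_ge0.
(* The residual of projecting [u] on [v], scaled by [dotv v v] to avoid a division. *)
have := dotvv_ge0 (dotv v v *: u - dotv u v *: v).
rewrite -scaleNr dotvDl !dotvDr !dotvZl !dotvZr (dotvC v u) => h.
have {h} : 0 <= dotv v v * (dotv u u * dotv v v - dotv u v ^+ 2) by nra.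
rewrite pmulr_rge0// subr_ge0 -!sqr_norm2 -exprMn => h.
have := mulr_ge0 (norm2_ge0 u) (norm2_ge0 v).
by case: (leP (dotv u v) (norm2 u * norm2 v)) => //; nra.
Qed.

Lemma ge_dotv_norm2 u v : - (norm2 u * norm2 v) <= dotv u v.
Proof.
have := le_dotv_norm2 (- u) v.
by rewrite norm2N -scaleN1r dotvZl; lra.
Qed.

Lemma norm2D u v : norm2 (u + v) <= norm2 u + norm2 v.
Proof.
rewrite -(@ler_pXn2r _ 2) ?nnegrE ?addr_ge0 ?norm2_ge0//.
rewrite sqr_norm2 dotvDl !dotvDr (dotvC v u) sqrrD -!sqr_norm2.
have := le_dotv_norm2 u v; lra.
Qed.

Lemma dist2_triangle w u v : norm2 (u - v) <= norm2 (u - w) + norm2 (w - v).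
Proof. by have := norm2D (u - w) (w - v); rewrite addrA subrK. Qed.

End Euclidean.

(** * Second-order Taylor bound in one variable *)

Section Lines.
Context {R : realType}.

(** The mean value theorem is used twice, for [p'] and then for [p] minus its quadratic minorant;
    [p''] is not assumed continuous, so nothing is integrated. *)
Lemma taylor2_ge (p p' p'' : R -> R) (c : R) :
  (forall x : R, is_derive x (1 : R) p (p' x)) ->
  (forall x : R, is_derive x (1 : R) p' (p'' x)) ->
  (forall x : R, 0 <= x <= 1 -> c <= p'' x) ->
  p 0 + p' 0 + c / 2 <= p 1.
Proof.
move=> dp dp' hc.
have mono (x : R) : 0 <= x <= 1 -> c * x <= p' x - p' 0.
  case/andP=> x0 x1.
  have cp' : {within `[0, x], continuous p'}%classic.
    by apply: derivable_within_continuous => z _; have [] := dp' z.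
  have [z /itvP zx ->] := MVT_segment x0 (fun z _ => dp' z) cp'.
  by rewrite subr0 ler_wpM2r// hc// zx (le_trans _ x1) ?zx.
pose q x := p x - p' 0 * x - c / 2 * x ^+ 2.
have dq (x : R) : is_derive x (1 : R) q (p' x - p' 0 - c * x).
  have dpx := dp x.
  by rewrite /q; apply: is_derive_eq; rewrite /GRing.scale/=; field.
have cq : {within `[0, 1], continuous q}%classic.
  by apply: derivable_within_continuous => z _; have [] := dq z.
have [z /itvP z01] := MVT_segment ler01 (fun z _ => dq z) cq.
have := mono z; rewrite !z01 => /(_ isT).
rewrite /q expr0n !mulr0 !subr0 mulr1 => ? ?; lra.
Qed.

End Lines.

(** * From Hessian bounds to quadratic bounds in a ball *)

Section Taylor.
Context {R : realType} {d : nat}.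
Implicit Types (f : 'rV[R]_d -> R) (x y v : 'rV[R]_d).

Lemma is_derive_line f x v (t : R) : derivable f (x + t *: v) v ->
  is_derive t (1 : R) (fun s : R => f (x + s *: v)) ('D_v f (x + t *: v)).
Proof.
have e : (fun h : R => h^-1 *: (((fun s : R => f (x + s *: v)) \o shift t) (h *: (1 : R))
    - f (x + t *: v))) =
  (fun h : R => h^-1 *: ((f \o shift (x + t *: v)) (h *: v) - f (x + t *: v))).
  apply: funext => h /=; congr (_ *: (f _ - _)).
  by rewrite /shift/= [h *: 1]mulr1 scalerDl addrCA addrA.
by move=> df; apply: DeriveDef; rewrite /derivable/derive e.
Qed.

Lemma derive_dotv f x v : differentiable f x -> 'D_v f x = dotv (grad f x) v.
Proof.
move=> df; rewrite deriveE// [in LHS](row_sum_delta v) linear_sum.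
by apply: eq_bigr => i _; rewrite linearZ mxE deriveE// mulrC.
Qed.

Lemma is_derive_line2 f x v (t : R) : twice_differentiable f ->
  is_derive t (1 : R) (fun s : R => dotv (grad f (x + s *: v)) v)
    (qform (hess f (x + t *: v)) v).
Proof.
move=> tdf; have [_ td2] := tdf (x + t *: v).
have -> : (fun s : R => dotv (grad f (x + s *: v)) v) =
    \sum_(i < d) (fun s : R => v 0 i *: 'D_(ev R i) f (x + s *: v)).
  apply: funext => s; rewrite fct_sumE; apply: eq_bigr => i _.
  by rewrite mxE mulrC.
apply: is_derive_eq.
  apply: is_derive_sum => i; apply: is_deriveZ.
  apply: (is_derive_line (fun y => 'D_(ev R i) f y)).
  exact: diff_derivable.
apply: eq_bigr => i _; rewrite derive_dotv// scaler_sumr.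
by apply: eq_bigr => j _; rewrite !mxE /GRing.scale/=; ring.
Qed.

Lemma taylor2_lower f x y (c : R) : twice_differentiable f ->
  (forall t : R, 0 <= t <= 1 ->
     c * dotv (y - x) (y - x) <= qform (hess f (x + t *: (y - x))) (y - x)) ->
  f x + dotv (grad f x) (y - x) + c / 2 * norm2 (y - x) ^+ 2 <= f y.
Proof.
move=> tdf hc.
have d1 (t : R) : is_derive t (1 : R) (fun s : R => f (x + s *: (y - x)))
    (dotv (grad f (x + t *: (y - x))) (y - x)).
  have [df _] := tdf (x + t *: (y - x)).
  by rewrite -derive_dotv//; apply/is_derive_line/diff_derivable.
have := taylor2_ge _ _ _ _ d1 (fun t => is_derive_line2 f x (y - x) t tdf) hc.
by rewrite scale1r scale0r addr0 (addrC x) subrK sqr_norm2 mulrAC.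
Qed.

Lemma taylor2_upper f x y (c : R) : twice_differentiable f ->
  (forall t : R, 0 <= t <= 1 ->
     qform (hess f (x + t *: (y - x))) (y - x) <= c * dotv (y - x) (y - x)) ->
  f y <= f x + dotv (grad f x) (y - x) + c / 2 * norm2 (y - x) ^+ 2.
Proof.
move=> tdf hc.
have d1 (t : R) : is_derive t (1 : R) (fun s : R => - f (x + s *: (y - x)))
    (- dotv (grad f (x + t *: (y - x))) (y - x)).
  have [df _] := tdf (x + t *: (y - x)).
  by rewrite -derive_dotv//; apply/is_deriveN/is_derive_line/diff_derivable.
have d2 (t : R) : is_derive t (1 : R)
    (fun s : R => - dotv (grad f (x + s *: (y - x))) (y - x))
    (- qform (hess f (x + t *: (y - x))) (y - x)).
  exact/is_deriveN/is_derive_line2.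
have := taylor2_ge _ _ _ (- (c * dotv (y - x) (y - x))) d1 d2.
rewrite scale1r scale0r addr0 (addrC x) subrK sqr_norm2 => h.
suff : - f x - dotv (grad f x) (y - x) + - (c * dotv (y - x) (y - x)) / 2 <= - f y
  by lra.
by apply: h => t t01; rewrite lerN2 hc.
Qed.

(* The radius [r] is a real number below [M], so that an infinite [M] needs no
   separate treatment. *)
Record tame f x0 (g : 'rV[R]_d) (r rho L : R) : Prop := Tame {
  tame_convex : convex_fun f;
  tame_lower : forall y, norm2 (y - x0) <= r ->
    f x0 + dotv g (y - x0) + rho / 2 * norm2 (y - x0) ^+ 2 <= f y;
  tame_upper : forall y, norm2 (y - x0) <= r ->
    f y <= f x0 + dotv g (y - x0) + L / 2 * norm2 (y - x0) ^+ 2;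
  tame_strong : forall x y (t : R), norm2 (x - x0) <= r -> norm2 (y - x0) <= r ->
    0 <= t <= 1 -> f (t *: x + (1 - t) *: y) <=
      t * f x + (1 - t) * f y - rho / 2 * (t * (1 - t)) * norm2 (x - y) ^+ 2 }.

Lemma ball_convex x0 x y (r t : R) : norm2 (x - x0) <= r -> norm2 (y - x0) <= r ->
  0 <= t <= 1 -> norm2 (x + t *: (y - x) - x0) <= r.
Proof.
move=> xr yr /andP[t0 t1].
have -> : x + t *: (y - x) - x0 = (1 - t) *: (x - x0) + t *: (y - x0).
  by apply/rowP => i; rewrite !mxE; ring.
apply: le_trans (norm2D _ _) _; rewrite !norm2Z !ger0_norm ?subr_ge0//.
by nra.
Qed.

Lemma regular_tame f x0 (M : \bar R) (rho L r : R) : regular f x0 M rho L ->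
  0 <= r -> (r%:E <= M)%E -> tame f x0 (grad f x0) r rho L.
Proof.
move=> [cf tdf hM _] r0 rM.
have x0r : norm2 (x0 - x0) <= r by rewrite subrr norm2_0.
have h x : norm2 (x - x0) <= r -> forall v,
    rho * dotv v v <= qform (hess f x) v <= L * dotv v v.
  move=> xr v; apply/andP; apply: hM; apply: le_trans rM; exact: xr.
have low x y : norm2 (x - x0) <= r -> norm2 (y - x0) <= r ->
    f x + dotv (grad f x) (y - x) + rho / 2 * norm2 (y - x) ^+ 2 <= f y.
  move=> xr yr; apply: taylor2_lower => // t t01.
  by have /andP[] := h _ (ball_convex x0 x y r t xr yr t01) (y - x).
split => //.
- by move=> y yr; apply: low.
- move=> y yr; apply: taylor2_upper => // t t01.
  by have /andP[] := h _ (ball_convex x0 x0 y r t x0r yr t01) (y - x0).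
move=> x y t xr yr t01.
(* Strong convexity: the quadratic lower bounds from [p] to [x] and to [y] are added with weights
   [t] and [1 - t], and the gradient terms cancel. *)
set p := t *: x + (1 - t) *: y.
have pE : p = y + t *: (x - y) by apply/rowP => i; rewrite !mxE; ring.
have pr : norm2 (p - x0) <= r by rewrite pE ball_convex.
have := low p x pr xr; have := low p y pr yr.
have -> : x - p = (1 - t) *: (x - y) by apply/rowP => i; rewrite !mxE; ring.
have -> : y - p = - t *: (x - y) by apply/rowP => i; rewrite !mxE; ring.
rewrite !dotvZr !norm2Z !exprMn !real_normK ?num_real// => h1 h2.
case/andP: t01 => t0 t1.
have {h2} := ler_wpM2l t0 h2.
have t1' : 0 <= 1 - t by rewrite subr_ge0.
have {h1} := ler_wpM2l t1' h1.
set a := dotv _ _; set b := norm2 _ ^+ 2; lra.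
Qed.

End Taylor.

(** * Linear growth and prox subproblems *)

Section TameGrowth.
Context {R : realType} {d : nat}.
Variables (f : 'rV[R]_d -> R) (x0 g : 'rV[R]_d) (r rho L eta : R).
Hypotheses (tf : tame f x0 g r rho L) (rho0 : 0 < rho) (r0 : 0 < r)
  (geta : norm2 g <= eta).

Let eta0 : 0 <= eta. Proof. exact: le_trans (norm2_ge0 g) geta. Qed.

Lemma tame_ge y : norm2 (y - x0) <= r ->
  f x0 - eta * norm2 (y - x0) + rho / 2 * norm2 (y - x0) ^+ 2 <= f y.
Proof.
move=> yr; apply: le_trans (tame_lower _ _ _ _ _ _ tf y yr).
have := ge_dotv_norm2 g (y - x0).
have := ler_wpM2r (norm2_ge0 (y - x0)) geta; lra.
Qed.

Lemma tame_le y : norm2 (y - x0) <= r ->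
  f y <= f x0 + eta * norm2 (y - x0) + L / 2 * norm2 (y - x0) ^+ 2.
Proof.
move=> yr; apply: le_trans (tame_upper _ _ _ _ _ _ tf y yr) _.
have := le_dotv_norm2 g (y - x0).
have := ler_wpM2r (norm2_ge0 (y - x0)) geta; lra.
Qed.

(* Each [a] gives a supporting line of the Huber-type minorant of [f]. *)
Lemma tame_growth (a : R) y : a <= rho * r / 2 ->
  f x0 + (a - eta) * norm2 (y - x0) - a ^+ 2 / (2 * rho) <= f y.
Proof.
move=> ar; set t := norm2 (y - x0).
have a2 : 0 <= a ^+ 2 / (2 * rho) by rewrite divr_ge0 ?sqr_ge0 ?mulr_ge0 ?ltW.
have [tr|rt] := leP t r.
  apply: le_trans (tame_ge y tr); rewrite -/t.
  suff : 0 <= rho / 2 * t ^+ 2 - a * t + a ^+ 2 / (2 * rho) by lra.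
  have -> : rho / 2 * t ^+ 2 - a * t + a ^+ 2 / (2 * rho) =
    (rho * t - a) ^+ 2 / (2 * rho) by field; rewrite gt_eqF.
  by rewrite divr_ge0 ?sqr_ge0// mulr_ge0 ?ltW.
have t0 : 0 < t := lt_trans r0 rt.
(* Outside the ball, [p] is the point of the sphere on the segment to [y]. The slope from [x0] to
   [p] is at least [rho * r / 2 - eta], and convexity carries it on to [y]. *)
pose p := (r / t) *: y + (1 - r / t) *: x0.
have np : norm2 (p - x0) = r.
  have -> : p - x0 = (r / t) *: (y - x0) by apply/rowP => i; rewrite !mxE; ring.
  by rewrite norm2Z ger0_norm ?divr_ge0 ?ltW// divfK ?gt_eqF.
have := tame_ge p; rewrite np => /(_ (lexx _)) h1.
have h2 : f p <= r / t * f y + (1 - r / t) * f x0.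
  by apply: (tame_convex _ _ _ _ _ _ tf); rewrite divr_ge0 ?ler_pdivrMr ?mul1r ?ltW.
have : t * (r * (rho * r / 2 - eta)) <= r * (f y - f x0).
  have : r * (rho * r / 2 - eta) <= r / t * (f y - f x0) by lra.
  move/(ler_wpM2l (ltW t0)) => h; apply: le_trans h _.
  by rewrite le_eqVlt; apply/orP; left; apply/eqP; field; rewrite gt_eqF.
rewrite mulrCA ler_pM2l// => h.
have := ler_wpM2r (ltW t0) ar; lra.
Qed.

(** The supporting line has slope [a - eta <= lam], so going from [y] to [b] raises it by no more
    than the penalty. *)
Lemma tame_growth_prox (a lam : R) b y :
  eta <= a -> a <= lam + eta -> a <= rho * r / 2 ->
  f x0 + (a - eta) * norm2 (b - x0) - a ^+ 2 / (2 * rho) <=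
    f y + lam * norm2 (b - y).
Proof.
move=> ea al ar; have := tame_growth a y ar.
have a0 : 0 <= a - eta by rewrite subr_ge0.
have := ler_wpM2l a0 (dist2_triangle y b x0).
have al' : a - eta <= lam by lra.
have := ler_wpM2r (norm2_ge0 (b - y)) al'; lra.
Qed.

(** Compares [y] with [x0]. At [a := 2 * (lam + eta)] the slope [a - eta] exceeds [lam] by
    [lam + eta], so the offset [a ^+ 2 / (2 * rho)] caps the distance. *)
Lemma tame_prox_dist (lam : R) y : 0 < lam -> 2 * (lam + eta) <= rho * r / 2 ->
  (forall p, f y <= f p + lam * norm2 (p - y)) ->
  norm2 (y - x0) <= 2 * (lam + eta) / rho.
Proof.
move=> lam0 hr /(_ x0); rewrite dist2C => h1.
have := tame_growth _ y hr; set t := norm2 _ => h2.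
have le0 : 0 < lam + eta by rewrite ltr_wpDr.
rewrite -(ler_pM2l le0).
have -> : (lam + eta) * (2 * (lam + eta) / rho) =
  (2 * (lam + eta)) ^+ 2 / (2 * rho) by field; rewrite gt_eqF.
rewrite -/t in h1; lra.
Qed.

(* Convexity at [b], between [y] and the point at distance [q] from [b] opposite
   to [y], bounds the slope of [f] at [b] without using gradients. *)
Lemma tame_prox_unique (lam q : R) b y :
  norm2 (b - x0) <= q -> 0 < q -> 2 * q <= r -> 3 * eta + 2 * L * q < lam ->
  0 <= L -> y != b -> f b < f y + lam * norm2 (b - y).
Proof.
move=> bq q0 qr hl L0 yb; set u := norm2 (b - y).
have u0 : 0 < u by rewrite lt_def norm2_eq0 subr_eq0 eq_sym yb norm2_ge0.
pose p := b + (q / u) *: (b - y).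
have pq : norm2 (p - x0) <= 2 * q.
  have -> : p - x0 = (b - x0) + (q / u) *: (b - y).
    by apply/rowP => i; rewrite !mxE; ring.
  apply: le_trans (norm2D _ _) _.
  rewrite norm2Z ger0_norm ?divr_ge0 ?(ltW q0) ?(ltW u0)// -/u divfK ?gt_eqF//; lra.
have uq0 : 0 < u + q by rewrite addr_gt0.
have bE : b = (q / (u + q)) *: y + (1 - q / (u + q)) *: p.
  apply/rowP => i; rewrite !mxE; field.
  by rewrite !gt_eqF.
have h1 : (u + q) * f b <= q * f y + u * f p.
  have s01 : 0 <= q / (u + q) <= 1.
    by rewrite divr_ge0 ?(ltW q0) ?(ltW uq0)//= ler_pdivrMr// mul1r lerDr ltW.
  have := tame_convex _ _ _ _ _ _ tf y p (q / (u + q)) s01.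
  rewrite -bE; move/(ler_wpM2l (ltW uq0)) => h; apply: le_trans h _.
  by rewrite le_eqVlt; apply/orP; left; apply/eqP; field; rewrite gt_eqF.
have h2 := tame_le p (le_trans pq qr).
have br : norm2 (b - x0) <= r by lra.
have h3 := tame_ge b br.
(* [eta] is charged over distance [2 * q] at [p] and [q] at [b]; the curvature term is
   [L / 2 * (2 * q) ^+ 2]. *)
have h4 : f p - f b <= 3 * eta * q + 2 * L * q ^+ 2.
  have := ler_wpM2l eta0 pq; have := ler_wpM2l eta0 bq.
  have := @ler_pXn2r R 2 isT (norm2 (p - x0)) (2 * q).
  rewrite !nnegrE norm2_ge0 mulr_ge0 ?(ltW q0)// => /(_ isT isT) e.
  have : norm2 (p - x0) ^+ 2 <= (2 * q) ^+ 2 by rewrite e.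
  move/(ler_wpM2l L0).
  have := mulr_ge0 (ltW rho0) (sqr_ge0 (norm2 (b - x0))); lra.
have h5 : u * (f p - f b) < u * (lam * q).
  rewrite ltr_pM2l//; apply: le_lt_trans h4 _.
  by rewrite -(ltr_pM2r q0) in hl; lra.
by rewrite -(ltr_pM2l q0); lra.
Qed.

End TameGrowth.

(* The distances are measured in units of [lam / L] and the objective in units
   of [lam ^+ 2 * rho / L ^+ 2]; both sides are then linear in [D]. *)
Lemma margin_lt (R : realType) (rho L lam v eta delta q N n mm D a : R) :
  0 < rho -> rho <= L -> 0 < lam -> 0 <= v -> v <= 1 / 2 ->
  eta = v * rho * lam / (12 * L) ->
  0 <= delta -> delta <= v * rho * lam / (26 * L ^+ 2) ->
  0 < q -> 0 <= mm -> v ^+ 2 * mm <= q / 2 -> 11 / 12 * q <= N ->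
  n <= q * rho / (12 * L) -> 7 / 20 * lam / L <= D ->
  a = 7 / 20 * lam * rho / L ->
  mm * (eta * delta + L / 2 * delta ^+ 2 + eta ^+ 2 / (2 * rho)) + lam * n * D <
  N * ((a - eta) * (D - delta) - a ^+ 2 / (2 * rho)).
Proof.
move=> rho0 rL lam0 v0 v2 etaE de0 de q0 mm0 vq Nq nq Dge aE.
have L0 : 0 < L := lt_le_trans rho0 rL.
have [L_neq0 rho_neq0 lam_neq0] : [/\ L != 0, rho != 0 & lam != 0].
  by rewrite !gt_eqF.
pose w := rho / L; pose y := D * L / lam; pose e := delta * L / lam.
have w0 : 0 < w by rewrite divr_gt0.
have w1 : w <= 1 by rewrite ler_pdivrMr// mul1r.
have y1 : 7 / 20 <= y.
  rewrite ler_pdivlMr//; move: Dge; rewrite ler_pdivrMr//; lra.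
have e0 : 0 <= e by rewrite divr_ge0 ?mulr_ge0// ?(ltW L0) ?(ltW lam0).
have e1 : e <= v * w / 26.
  rewrite ler_pdivrMr// -ler_pdivlMr//; apply: le_trans de _.
  by rewrite le_eqVlt; apply/orP; left; apply/eqP; rewrite /w; field; rewrite L_neq0.
pose c := lam ^+ 2 * rho / L ^+ 2.
have c0 : 0 < c by rewrite divr_gt0 ?mulr_gt0 ?exprn_gt0.
have -> : N * ((a - eta) * (D - delta) - a ^+ 2 / (2 * rho)) =
    c * (N * ((7 / 20 - v / 12) * (y - e) - 49 / 800)).
  by rewrite aE etaE /c /y /e; field; rewrite L_neq0 rho_neq0 lam_neq0.
have -> : mm * (eta * delta + L / 2 * delta ^+ 2 + eta ^+ 2 / (2 * rho)) + lam * n * D =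
    c * (mm * (v * e / 12 + e ^+ 2 / (2 * w) + v ^+ 2 / 288) + n / w * y).
  by rewrite etaE /c /y /e /w; field; rewrite L_neq0 rho_neq0 lam_neq0.
rewrite ltr_pM2l//.
have ew : e ^+ 2 / (2 * w) <= v ^+ 2 / 1352.
  have w2 : 0 < 2 * w by lra.
  rewrite ler_pdivrMr//.
  have : e ^+ 2 <= (v * w / 26) ^+ 2 by rewrite ler_pXn2r ?nnegrE// (le_trans e0).
  have : v ^+ 2 * (w * (1 - w)) >= 0.
    by rewrite mulr_ge0 ?sqr_ge0// mulr_ge0 ?subr_ge0// ltW.
  lra.
have ve : v * e / 12 <= v ^+ 2 / 312.
  have : v * e <= v * (v * w / 26) by rewrite ler_wpM2l.
  have : v ^+ 2 * (1 - w) >= 0 by rewrite mulr_ge0 ?sqr_ge0 ?subr_ge0.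
  lra.
(* The three constants sum to less than [1 / 125], and [v ^+ 2 * mm <= q / 2]. *)
have t1 : mm * (v * e / 12 + e ^+ 2 / (2 * w) + v ^+ 2 / 288) <= q / 250.
  have : mm * (v * e / 12 + e ^+ 2 / (2 * w) + v ^+ 2 / 288) <=
      mm * (v ^+ 2 * (1 / 312 + 1 / 1352 + 1 / 288)) by rewrite ler_wpM2l//; lra.
  lra.
have t2 : n / w * y <= q * y / 12.
  have nw : n / w <= q / 12.
    rewrite ler_pdivrMr//; apply: le_trans nq _.
    by rewrite le_eqVlt; apply/orP; left; apply/eqP; rewrite /w; field; rewrite L_neq0.
  have y0 : 0 <= y by lra.
  have := ler_wpM2r y0 nw; lra.
have e2 : e <= 1 / 52.
  have : v * w <= 1 / 2 * 1 by rewrite ler_pM// ltW.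
  lra.
have b1 : (7 / 20 - 1 / 24) * (y - 1 / 52) - 49 / 800 <=
    (7 / 20 - v / 12) * (y - e) - 49 / 800.
  by rewrite lerD2r ler_pM//; lra.
have b0 : 0 <= (7 / 20 - 1 / 24) * (y - 1 / 52) - 49 / 800 by lra.
have t3 : 11 / 12 * q * ((7 / 20 - 1 / 24) * (y - 1 / 52) - 49 / 800) <=
    N * ((7 / 20 - v / 12) * (y - e) - 49 / 800).
  by rewrite ler_pM//; lra.
(* The slope in [y], [11 / 12 * (37 / 120)] against [1 / 12], reduces the comparison to
   [y = 7 / 20], where about [0.0373 * q] beats [0.0332 * q]. *)
have : 0 <= q * (y - 7 / 20) by rewrite mulr_ge0 ?subr_ge0// ltW.
lra.
Qed.

Lemma le0_of_le_mul_small (R : realType) (x c : R) : 0 <= c ->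
  (forall t, 0 < t -> t < 1 -> x <= c * t) -> x <= 0.
Proof.
move=> c0 h; case: leP => // x0.
have s0 : 0 < x + c + 1 by lra.
(* This [t] turns the bound into [x * (x + 1) <= 0]. *)
have := h (x / (x + c + 1)); rewrite divr_gt0// ltr_pdivrMr// mul1r.
rewrite mulrA ler_pdivlMr//.
move=> /(_ isT) hx; have {hx} := hx _; have -> : x < x + c + 1 by lra.
move=> /(_ isT); have := mulr_gt0 x0 x0; lra.
Qed.

(** * Exact recovery of the clusters *)

Section Recovery.
Context {R : realType} {d m K : nat}.
Variables (f : 'I_m -> 'rV[R]_d -> R) (rho L lam alpha v eta delta : R).
Variables (betastar : 'I_K -> 'rV[R]_d) (zstar : 'I_m -> 'I_K).
Variables (thetastar : 'I_m -> 'rV[R]_d) (S : {set 'I_m}).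
Variables (Thh : 'I_m -> 'rV[R]_d) (Bh : 'I_K -> 'rV[R]_d) (zh : 'I_m -> 'I_K).

(** The cluster size that feasibility demands. In the application [v] is [sqrt alpha / K]. *)
Let q := alpha * m%:R / K%:R.
Let T (k : 'I_K) := [set j | zstar j == k].
Let cost j := f j (Thh j) + lam * norm2 (Bh (zh j) - Thh j).

Hypotheses (rho0 : 0 < rho) (rL : rho <= L) (lam0 : 0 < lam) (q0 : 0 < q).
(** The radius is the one that [lam < rho / 6 * M] keeps inside the ball of regularity. *)
Hypothesis tf : forall j, j \in S ->
  tame (f j) (thetastar j) (grad (f j) (thetastar j)) (6 * lam / rho) rho L.
Hypothesis geta : forall j, j \in S -> norm2 (grad (f j) (thetastar j)) <= eta.
Hypotheses (v0 : 0 <= v) (v2 : v <= 1 / 2) (vq : v ^+ 2 * m%:R <= q / 2).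
Hypothesis etaE : eta = v * rho * lam / (12 * L).
Hypotheses (de0 : 0 <= delta) (de : delta <= v * rho * lam / (26 * L ^+ 2)).
Hypothesis hde : forall j, j \in S ->
  norm2 (thetastar j - betastar (zstar j)) <= delta.
Hypothesis hout : #|~: S|%:R <= q * rho / (12 * L).
Hypothesis hT : forall k, 13 / 12 * q <= #|T k :&: S|%:R.
Hypothesis hsep : forall k l : 'I_K, k != l ->
  lam < rho / 6 * norm2 (betastar k - betastar l).
Hypothesis feas : feasible alpha zh.
Hypothesis opt : forall (Th : 'I_m -> 'rV[R]_d) (B : 'I_K -> 'rV[R]_d)
  (z : 'I_m -> 'I_K), feasible alpha z ->
  objective f lam Thh Bh zh <= objective f lam Th B z.

Let L0 : 0 < L. Proof. exact: lt_le_trans rL. Qed.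
Let r0 : 0 < 6 * lam / rho. Proof. by rewrite divr_gt0// mulr_gt0. Qed.
Let u0 : 0 < lam / L. Proof. by rewrite divr_gt0. Qed.
Let urho : lam / L <= lam / rho.
Proof. by rewrite ler_pM2l// lef_pV2. Qed.
Let w1 : rho / L <= 1. Proof. by rewrite ler_pdivrMr// mul1r. Qed.
Let w0 : 0 < rho / L. Proof. by rewrite divr_gt0. Qed.
Let vw : v * (rho / L) <= 1 / 2.
Proof. by have := ler_pM v0 (ltW w0) v2 w1; rewrite mulr1. Qed.
Let eta0 : 0 <= eta.
Proof. by rewrite etaE divr_ge0 ?mulr_ge0 ?(ltW rho0) ?(ltW lam0) ?(ltW L0). Qed.
Let eta_w : eta <= rho / L * lam / 24.
Proof.
have -> : eta = v * (rho / L * lam / 12).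
  by rewrite etaE; field; rewrite gt_eqF.
have : 0 <= rho / L * lam by rewrite mulr_ge0 ?(ltW w0) ?(ltW lam0).
by move=> h; have := ler_wpM2r h v2; lra.
Qed.
Let eta_lam : eta <= lam / 24.
Proof. by have := ler_wpM2r (ltW lam0) w1; move: eta_w; lra. Qed.
Let de_u : delta <= lam / L / 52.
Proof.
apply: le_trans de _.
have -> : v * rho * lam / (26 * L ^+ 2) = v * (rho / L) * (lam / L) / 26.
  by field; rewrite gt_eqF.
by have := ler_wpM2r (ltW u0) vw; lra.
Qed.

Let tgrowth (a : R) j b : j \in S -> eta <= a -> a <= lam + eta ->
  f j (thetastar j) + (a - eta) * norm2 (b - thetastar j) - a ^+ 2 / (2 * rho) <=
  f j (Thh j) + lam * norm2 (b - Thh j).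
Proof.
move=> jS ea al; apply: (tame_growth_prox _ _ _ _ _ _ _ (tf j jS)) => //.
- exact: geta.
- have -> : rho * (6 * lam / rho) / 2 = 3 * lam by field; rewrite gt_eqF.
  by move: eta_lam; lra.
Qed.

(** Minimality is always used in this form: a competitor is judged by a lower bound [h j] on its
    saving at each index. *)
Lemma objective_diff Th B (z : 'I_m -> 'I_K) (h : 'I_m -> R) : feasible alpha z ->
  (forall j, h j <= cost j - (f j (Th j) + lam * norm2 (B (z j) - Th j))) ->
  \sum_(j < m) h j <= 0.
Proof.
move=> fz hh; apply: le_trans (ler_sum _ (fun j _ => hh j)) _.
by rewrite sumrB subr_le0 opt.
Qed.

(** Each label receives the part in [S] of a whole true cluster, which alone exceeds [q]. *)
Lemma feasible_relabel (z : 'I_m -> 'I_K) : (forall k, exists l,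
  forall j, j \in S -> zstar j = l -> z j = k) -> feasible alpha z.
Proof.
move=> hz k; have [l hl] := hz k.
apply: (@le_trans _ _ #|T l :&: S|%:R).
  by apply: le_trans (hT l); move: q0; rewrite -/q; lra.
rewrite ler_nat subset_leq_card//; apply/fintype.subsetP => j; rewrite !inE.
by case/andP => /eqP jl jS; rewrite (hl j).
Qed.

(* Competitor: [betastar], the labels [zstar] on [S], and each outlier relabelled
   by [c]; it pays at most [lam * D] more per outlier. *)
Lemma no_far_cluster (c : 'I_K -> 'I_K) (W : {set 'I_m}) (D : R) :
  W \subset S -> 11 / 12 * q <= #|W|%:R -> 7 / 20 * (lam / L) <= D ->
  (forall k, norm2 (Bh k - betastar (c k)) <= D) ->
  (forall j, j \in W -> D - delta <= norm2 (Bh (zh j) - thetastar j)) -> False.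
Proof.
move=> WS cW Dge hD hW.
(* [rho] times the distance [7 / 20 * (lam / L)]: the supporting line that touches the quadratic
   minorant at that distance. *)
pose a := 7 / 20 * lam * rho / L.
have aE : a = 7 / 20 * (rho / L * lam) by rewrite /a; field; rewrite gt_eqF.
have wl : 0 < rho / L * lam by rewrite mulr_gt0.
have ea : eta <= a by rewrite aE; move: eta_w; lra.
have al : a <= lam + eta.
  by rewrite aE; have := ler_wpM2r (ltW lam0) w1; move: eta0; lra.
(* Bounds the loss at an index of [S]: two terms for moving to [betastar], the last because
   [thetastar j] need not minimize [f j]. *)
pose e := eta * delta + L / 2 * delta ^+ 2 + eta ^+ 2 / (2 * rho).
have e0 : 0 <= e.
  have : 0 <= eta ^+ 2 / (2 * rho) by rewrite divr_ge0 ?sqr_ge0 ?mulr_ge0 ?(ltW rho0).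
  have : 0 <= L / 2 * delta ^+ 2 by rewrite mulr_ge0 ?sqr_ge0 ?divr_ge0 ?(ltW L0).
  by have := mulr_ge0 eta0 de0; rewrite /e; lra.
pose X := (a - eta) * (D - delta) - a ^+ 2 / (2 * rho).
have D0 : 0 <= D by move: u0; lra.
pose z j := if j \in S then zstar j else c (zh j).
pose Th j := if j \in S then betastar (zstar j) else Thh j.
pose h j := (if j \in W then X else 0) - e - (if j \notin S then lam * D else 0).
have fz : feasible alpha z.
  by apply: feasible_relabel => k; exists k => j jS <-; rewrite /z jS.
have : \sum_(j < m) h j <= 0.
  apply: (objective_diff Th betastar z) => // j; rewrite /h /z /Th /cost.
  have [jS|jS] /= := boolP (j \in S); last first.
    rewrite (negbTE (contraNN (fintype.subsetP WS j) jS)).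
    have := ler_wpM2l (ltW lam0) (dist2_triangle (Bh (zh j)) (betastar (c (zh j))) (Thh j)).
    have := ler_wpM2l (ltW lam0) (hD (zh j)).
    by rewrite [norm2 (Bh _ - betastar _)]dist2C; lra.
  have dj := hde j jS; rewrite dist2C in dj.
  have f1 : f j (betastar (zstar j)) <=
      f j (thetastar j) + eta * delta + L / 2 * delta ^+ 2.
    apply: le_trans (tame_le _ _ _ _ _ _ _ (tf j jS) (geta j jS) _ _) _.
      by apply: le_trans dj _; move: de_u u0 urho; lra.
    rewrite -!addrA lerD2l lerD// ?ler_wpM2l ?divr_ge0 ?(ltW L0)//.
    by rewrite ler_pXn2r ?nnegrE ?norm2_ge0.
  have e1 : eta <= lam + eta by rewrite lerDr ltW.
  rewrite subrr norm2_0 mulr0 addr0 subr0.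
  have g0 := tgrowth eta j (Bh (zh j)) jS (lexx _) e1.
  have [jW|jW] := boolP (j \in W).
    have ga := tgrowth a j (Bh (zh j)) jS ea al.
    have ae : 0 <= a - eta by rewrite subr_ge0.
    have := ler_wpM2l ae (hW j jW).
    have : 0 <= eta ^+ 2 / (2 * rho) by rewrite divr_ge0 ?sqr_ge0 ?mulr_ge0 ?(ltW rho0).
    by rewrite /X /e; lra.
  by rewrite /e; lra.
have sumc (A : {set 'I_m}) (x : R) : \sum_(j < m | j \in A) x = #|A|%:R * x.
  by rewrite sumr_const mulr_natl.
have -> : \sum_(j < m) h j = #|W|%:R * X - m%:R * e - #|~: S|%:R * (lam * D).
  rewrite /h !big_split/= !sumrN -!sumc -!big_mkcond/=.
  congr (_ - _ - _); last by apply: eq_bigl => j; rewrite inE.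
  by rewrite sumr_const card_ord mulr_natl.
have := margin_lt R rho L lam v eta delta q #|W|%:R #|~: S|%:R m%:R D a
  rho0 rL lam0 v0 v2 etaE de0 de q0 (ler0n _ _) vq cW hout _ erefl.
rewrite -mulrA => /(_ Dge); rewrite -/e -/X; lra.
Qed.


Let out_le : #|~: S|%:R <= q / 12.
Proof.
apply: le_trans hout _.
have -> : q * rho / (12 * L) = q / 12 * (rho / L) by field; rewrite gt_eqF.
by rewrite ler_piMr// divr_ge0// ltW.
Qed.

(** [c] picks the nearest true centre and [k1] is the worst fitted cluster. Its distance serves as
    [D]: it caps the charge of every outlier, and, [c] being nearest, each member of cluster [k1] in
    [S] is at least that far from its own true centre. At least [q - q / 12] members lie in [S]. *)
Lemma centers_near : exists c : 'I_K -> 'I_K,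
  forall k, norm2 (Bh k - betastar (c k)) < 7 / 20 * (lam / L).
Proof.
pose c k := [arg min_(l < k) norm2 (Bh k - betastar l)]%O.
have cP k l : norm2 (Bh k - betastar (c k)) <= norm2 (Bh k - betastar l).
  by rewrite /c; case: Order.TotalTheory.arg_minP => // i _ /(_ l isT).
exists c => k0.
pose k1 := [arg max_(k > k0) norm2 (Bh k - betastar (c k))]%O.
have k1P k : norm2 (Bh k - betastar (c k)) <= norm2 (Bh k1 - betastar (c k1)).
  by rewrite /k1; case: Order.TotalTheory.arg_maxP => // i _ /(_ k isT).
apply: le_lt_trans (k1P k0) _; rewrite ltNge; apply/negP => D1.
pose W := [set j | zh j == k1] :&: S.
apply: (no_far_cluster c W _ (finset.subsetIr _ _) _ D1 k1P) => [|j].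
  have := feas k1; rewrite -(cardsID S [set j | zh j == k1]) natrD -/W -/q.
  have : #|[set j | zh j == k1] :\: S|%:R <= #|~: S|%:R :> R.
    by rewrite ler_nat subset_leq_card// finset.setDE finset.subsetIr.
  by move: out_le; lra.
rewrite !inE => /andP[/eqP jk jS]; rewrite lerBlDr.
apply: le_trans (cP k1 (zstar j)) _; rewrite jk.
apply: le_trans (dist2_triangle (thetastar j) _ _) _.
by rewrite lerD2l hde.
Qed.

(** Otherwise all of [T l :&: S], already larger than [q], would be a far set. *)
Lemma centers_hit l : exists j, [/\ j \in S, zstar j = l &
  norm2 (Bh (zh j) - thetastar j) < 7 / 20 * (lam / L)].
Proof.
have [c hc] := centers_near.
apply: contrapT => hN.
apply: (no_far_cluster c (T l :&: S) (7 / 20 * (lam / L)) (finset.subsetIr _ _)) => //.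
- by apply: le_trans (hT l); move: q0; lra.
- by move=> k; apply: ltW.
move=> j; rewrite !inE => /andP[/eqP jl jS].
suff : 7 / 20 * (lam / L) <= norm2 (Bh (zh j) - thetastar j) by move: de0; lra.
by rewrite leNgt; apply/negP => h; apply: hN; exists j.
Qed.

(** One well-fitted member per true cluster defines a label map. It is injective: two true centres
    near one fitted centre would be within [lam / rho], against a separation of [6 * lam / rho]. *)
Lemma centers_matched : exists tau : {perm 'I_K},
  forall l, norm2 (Bh (tau l) - betastar l) <= 7 / 20 * (lam / L) + delta.
Proof.
have [g hg] := choice centers_hit.
pose s l := zh (g l).
have hs l : norm2 (Bh (s l) - betastar l) <= 7 / 20 * (lam / L) + delta.
  have [jS jl hj] := hg l.
  apply: le_trans (dist2_triangle (thetastar (g l)) _ _) _.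
  by rewrite lerD ?(ltW hj)// -[in betastar l]jl hde.
have s_inj : injective s.
  move=> k l e; apply/eqP/negPn/negP => /hsep.
  have := dist2_triangle (Bh (s k)) (betastar k) (betastar l).
  have := hs k; have := hs l; rewrite e (dist2C (betastar k) (Bh _)) => h1 h2 h3.
  have h4 : norm2 (betastar k - betastar l) <= lam / rho.
    by move: de_u urho u0; lra.
  have := ler_wpM2l (ltW rho0) h4.
  by rewrite mulrCA divff ?gt_eqF// mulr1; move: lam0; lra.
by exists (perm s_inj) => l; rewrite permE.
Qed.

(** [7 / 20] plus twice the bound [1 / 52] on [delta], in units of [lam / L], stays below
    [2 / 5]. *)
Lemma near_center (tau : {perm 'I_K}) :
  (forall l, norm2 (Bh (tau l) - betastar l) <= 7 / 20 * (lam / L) + delta) ->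
  forall j, j \in S ->
    norm2 (Bh (tau (zstar j)) - thetastar j) <= 2 / 5 * (lam / L).
Proof.
move=> htau j jS.
apply: le_trans (dist2_triangle (betastar (zstar j)) _ _) _.
have := htau (zstar j); have := hde j jS; rewrite dist2C.
by move: de_u u0; lra.
Qed.

(* The competitor relabels all of [S] at once, because changing one label alone
   could break feasibility. *)
Lemma labels_exact (tau : {perm 'I_K}) :
  (forall l, norm2 (Bh (tau l) - betastar l) <= 7 / 20 * (lam / L) + delta) ->
  forall j, j \in S -> zh j = tau (zstar j) /\ Thh j = Bh (zh j).
Proof.
move=> htau j0 j0S; apply: contrapT => bad.
pose z j := if j \in S then tau (zstar j) else zh j.
pose Th j := if j \in S then Bh (tau (zstar j)) else Thh j.
pose h j := cost j - (f j (Th j) + lam * norm2 (Bh (z j) - Th j)).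
have fz : feasible alpha z.
  apply: feasible_relabel => k; exists (tau^-1 k)%g => j jS e.
  by rewrite /z jS e permKV.
have hS j : j \in S -> 0 < h j \/ h j = 0 /\ zh j = tau (zstar j) /\ Thh j = Bh (zh j).
  move=> jS; rewrite /h /Th /z jS subrr norm2_0 mulr0 addr0 /cost.
  have nr := near_center tau htau j jS.
  have [zE|zN] := eqVneq (zh j) (tau (zstar j)).
    rewrite zE; have [->|ne] := eqVneq (Thh j) (Bh (tau (zstar j))).
      by right; rewrite subrr norm2_0; split; [lra|].
    left; rewrite subr_gt0.
    (* Right label but [Thh j] off the centre: within [2 / 5 * (lam / L)] the slope bound
       [3 * eta + 4 / 5 * lam] is below [lam]. *)
    apply: (tame_prox_unique _ _ _ _ _ _ _ (tf j jS) _ (geta j jS) _ (2 / 5 * (lam / L))) => //.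
    - by rewrite mulr_gt0.
    - by move: urho u0; lra.
    - have -> : 2 * L * (2 / 5 * (lam / L)) = 4 / 5 * lam by field; rewrite gt_eqF.
      by move: eta_lam lam0; lra.
    - exact: ltW.
  left; rewrite subr_gt0.
  set l := (tau^-1 (zh j))%g.
  have lE : zh j = tau l by rewrite permKV.
  have ln : zstar j != l by apply: contraNN zN => /eqP ->; rewrite lE.
  (* Wrong label: the separation [6 * (lam / rho)] less errors of at most [lam / rho]. *)
  have far : 5 * (lam / rho) <= norm2 (Bh (zh j) - thetastar j).
    have h1 := dist2_triangle (thetastar j) (betastar (zstar j)) (betastar l).
    have h2 := dist2_triangle (Bh (zh j)) (thetastar j) (betastar l).
    have h3 := htau l; rewrite -lE in h3.
    have h4 := hde j jS; rewrite dist2C in h4.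
    rewrite (dist2C (thetastar j) (Bh _)) in h2.
    have h5 : 6 * (lam / rho) <= norm2 (betastar (zstar j) - betastar l).
      have -> : 6 * (lam / rho) = lam / (rho / 6) by field; rewrite gt_eqF.
      rewrite ler_pdivrMr ?divr_gt0// mulrC.
      exact/ltW/hsep.
    by move: de_u urho u0; lra.
  have e1 : eta <= lam + eta by rewrite lerDr ltW.
  (* The slope is exactly [lam]: the fitted cost exceeds [f j (thetastar j)] by at least
     [4 * lam ^+ 2 / rho], that of the competitor by at most a tenth of [lam ^+ 2 / L]. *)
  have := tgrowth (lam + eta) j (Bh (zh j)) jS e1 (lexx _).
  rewrite addrK => g1.
  have g2 := ler_wpM2l (ltW lam0) far.
  have rr : norm2 (Bh (tau (zstar j)) - thetastar j) <= 6 * lam / rho.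
    by move: urho u0; lra.
  have g3 := tame_le _ _ _ _ _ _ _ (tf j jS) (geta j jS) _ rr.
  have g4 := ler_pM eta0 (norm2_ge0 _) eta_lam nr.
  have g5 : norm2 (Bh (tau (zstar j)) - thetastar j) ^+ 2 <= (2 / 5 * (lam / L)) ^+ 2.
    by rewrite ler_pXn2r ?nnegrE ?norm2_ge0// mulr_ge0// ltW.
  have L2 : 0 <= L / 2 by rewrite divr_ge0// ltW.
  have {g5} := ler_wpM2l L2 g5.
  have -> : L / 2 * (2 / 5 * (lam / L)) ^+ 2 = 2 / 25 * (lam * (lam / L)).
    by field; rewrite gt_eqF.
  have lu := ler_wpM2l (ltW lam0) urho.
  have lr : 0 < lam * (lam / rho) by rewrite mulr_gt0// divr_gt0.
  have g6 : (lam + eta) ^+ 2 / (2 * rho) <= (lam * (lam / rho)).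
    have -> : lam * (lam / rho) = (lam ^+ 2 * 2) / (2 * rho) by field; rewrite gt_eqF.
    rewrite ler_pM2r ?invr_gt0 ?mulr_gt0//.
    have : (lam + eta) ^+ 2 <= (lam * (25 / 24)) ^+ 2.
      by rewrite ler_pXn2r// ?nnegrE; move: eta_lam eta0 lam0; lra.
    by have := sqr_ge0 lam; lra.
  by move: g1 g2 g3 g4 g6 lu lr; lra.
have h0 j : 0 <= h j.
  have [/hS [/ltW//|[-> _]]//|jS] := boolP (j \in S).
  by rewrite /h /Th /z (negbTE jS) /cost subrr.
have := objective_diff Th Bh z h fz (fun=> lexx _).
rewrite (bigD1 j0)//= leNgt => /negP; apply; apply: ltr_wpDr; first exact: sumr_ge0.
by have [|[_ /bad]] := hS j0 j0S.
Qed.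


(* Compares the cluster centre with the nearby points of the segment to
   [thetastar i]. *)
Lemma center_dist (tau : {perm 'I_K}) i :
  (forall l, norm2 (Bh (tau l) - betastar l) <= 7 / 20 * (lam / L) + delta) ->
  i \in S ->
  rho * #|T (zstar i) :&: S|%:R * norm2 (Bh (zh i) - thetastar i) <=
    norm2 (\sum_(k in T (zstar i) :&: S) grad (f k) (thetastar k)) +
    4 * L * delta * #|T (zstar i) :&: S|%:R + lam * #|~: S|%:R.
Proof.
move=> htau iS; set TS := T (zstar i) :&: S; set n : R := #|TS|%:R.
have hl := labels_exact tau htau.
set G := \sum_(k in TS) _; set b := Bh (zh i); set x := thetastar i.
set w := norm2 (b - x).
have n0 : 0 <= n :> R by rewrite ler0n.
have w_ge0 : 0 <= w := norm2_ge0 _.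
have out0 : 0 <= lam * #|~: S|%:R := mulr_ge0 (ltW lam0) (ler0n _ _).
(* If [w <= delta], then [rho * w <= L * delta] and the [delta] term suffices. *)
have [wd|dw] := leP w delta.
  have Lw := ler_pM (ltW rho0) w_ge0 rL wd.
  have := ler_wpM2l n0 Lw.
  have := mulr_ge0 (mulr_ge0 (ltW L0) de0) n0; have := norm2_ge0 G; lra.
(* A lower bound on the rate at which moving the centre towards [x] saves cost. *)
pose X := dotv G (b - x) +
  n * (rho * w ^+ 2 - 2 * rho * delta * w - 2 * L * delta ^+ 2) - #|~: S|%:R * (lam * w).
have X0 : X <= 0.
  apply: (@le0_of_le_mul_small R X (n * (rho * w ^+ 2))).
    by rewrite mulr_ge0// mulr_ge0 ?sqr_ge0// ltW.
  move=> t t0 t1.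
  pose p := t *: x + (1 - t) *: b.
  have pb : p - b = t *: (x - b) by apply/rowP => k; rewrite !mxE; ring.
  pose B k := if k == zh i then p else Bh k.
  pose Th j := if j \in TS then p else Thh j.
  (* Bounds the saving at [j] divided by [t]; the last term is an error that vanishes with [t]. *)
  pose Y j := dotv (grad (f j) (thetastar j)) (b - x) +
    (rho * w ^+ 2 - 2 * rho * delta * w - 2 * L * delta ^+ 2 - rho * w ^+ 2 * t).
  pose h j := (if j \in TS then t * Y j else 0) -
    (if j \in ~: S then t * (lam * w) else 0).
  have xr j : j \in TS -> norm2 (x - thetastar j) <= 2 * delta.
    rewrite !inE => /andP[/eqP jz jS].
    apply: le_trans (dist2_triangle (betastar (zstar i)) _ _) _.
    have := hde i iS; have := hde j jS; rewrite jz (dist2C (thetastar j)) -/x; lra.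
  have : \sum_(j < m) h j <= 0.
    apply: (objective_diff Th B zh) => // j; rewrite /h /Th /B /cost.
    have [jTS|jTS] := boolP (j \in TS).
      have := jTS; rewrite !inE => /andP[/eqP jz jS]; rewrite jS/= subr0.
      have [jl jT] := hl j jS; have [il _] := hl i iS.
      have zji : zh j = zh i by rewrite jl jz il.
      rewrite jT zji eqxx -/b !subrr norm2_0 mulr0 !addr0.
      have br : norm2 (b - thetastar j) <= 6 * lam / rho.
        have := near_center tau htau j jS; rewrite -jl zji -/b.
        by move: urho u0; lra.
      have xj := xr j jTS.
      have xr' : norm2 (x - thetastar j) <= 6 * lam / rho.
        by move: de_u urho u0; lra.
      have t01 : 0 <= t <= 1 by rewrite !ltW.
      have := tame_strong _ _ _ _ _ _ (tf j jS) x b t xr' br t01.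
      rewrite (dist2C x) -/w -/p => h1.
      have h2 := tame_lower _ _ _ _ _ _ (tf j jS) b br.
      have h3 := tame_upper _ _ _ _ _ _ (tf j jS) x xr'.
      have h4 : dotv (grad (f j) (thetastar j)) (b - thetastar j) =
          dotv (grad (f j) (thetastar j)) (b - x) +
          dotv (grad (f j) (thetastar j)) (x - thetastar j).
        by rewrite -dotvDr addrA subrK.
      have h5 : L / 2 * norm2 (x - thetastar j) ^+ 2 <= 2 * L * delta ^+ 2.
        have : norm2 (x - thetastar j) ^+ 2 <= (2 * delta) ^+ 2.
          by rewrite ler_pXn2r ?nnegrE ?norm2_ge0// mulr_ge0.
        have L2 : 0 <= L / 2 by rewrite divr_ge0// ltW.
        by move/(ler_wpM2l L2); lra.
      have h6 : w ^+ 2 - 4 * delta * w <= norm2 (b - thetastar j) ^+ 2.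
        have h7 : w - 2 * delta <= norm2 (b - thetastar j).
          have := dist2_triangle (thetastar j) b x.
          by rewrite (dist2C (thetastar j)) -/w; lra.
        have [w2|w2] := leP (2 * delta) w.
          have : (w - 2 * delta) ^+ 2 <= norm2 (b - thetastar j) ^+ 2.
            by rewrite ler_pXn2r ?nnegrE ?norm2_ge0 ?subr_ge0.
          by have := sqr_ge0 delta; lra.
        have : w * (w - 4 * delta) <= 0 by rewrite mulr_ge0_le0//; lra.
        by have := sqr_ge0 (norm2 (b - thetastar j)); lra.
      have r2 : 0 <= rho / 2 by rewrite divr_ge0// ltW.
      have h8 := ler_wpM2l r2 h6.
      (* One half of the [rho * w ^+ 2] in [Y]; [tame_strong] on the segment supplies the other. *)
      have h9 : dotv (grad (f j) (thetastar j)) (b - x) + rho / 2 * w ^+ 2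
          - 2 * rho * delta * w - 2 * L * delta ^+ 2 <= f j b - f j x by lra.
      have h10 := ler_wpM2l (ltW t0) h9.
      have h11 : 0 <= rho * w ^+ 2 * (t * t).
        by rewrite mulr_ge0 ?mulr_ge0 ?sqr_ge0 ?(ltW rho0) ?(ltW t0).
      by rewrite /Y; lra.
    (* Within [S], sharing the label of [i] means lying in [TS], so only outliers pay for the moved
       centre. *)
    rewrite sub0r; have [jS|jS] := boolP (j \in S).
      rewrite !inE jS/= oppr0; case: eqP => [zji|_]; last by rewrite subrr.
      have [jl _] := hl j jS; have [il _] := hl i iS.
      case/negP: jTS; rewrite !inE jS andbT.
      by apply/eqP/(@perm_inj _ tau); rewrite -jl zji il.
    rewrite !inE jS/=; case: eqP => [->|_].
      have := ler_wpM2l (ltW lam0) (dist2_triangle b p (Thh j)).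
      have : norm2 (p - b) = t * w by rewrite pb norm2Z ger0_norm ?(ltW t0)// dist2C.
      rewrite -/b => -> ; lra.
    by rewrite subrr oppr_le0 !mulr_ge0 ?(ltW t0) ?(ltW lam0).
  rewrite /h big_split/= sumrN -!big_mkcond/= -mulr_sumr.
  rewrite sumr_const -mulr_natl mulrCA -mulrBr pmulr_rle0//.
  rewrite /Y big_split/= sumr_const -mulr_natl -dotv_suml -/G -/n /X; lra.
(* Dividing by [w > delta] brings each of the two error terms below [2 * L * delta], whence the
   [4]. *)
rewrite -(@ler_pM2r _ w) ?(le_lt_trans de0)//.
have := ge_dotv_norm2 G (b - x); rewrite -/w => h1.
have h2 : n * (2 * rho * delta * w) <= n * (2 * L * delta * w).
  by rewrite ler_wpM2l// !ler_wpM2r// ler_wpM2l.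
have h3 : n * (2 * L * delta ^+ 2) <= n * (2 * L * delta * w).
  rewrite ler_wpM2l// expr2 mulrA ler_wpM2l ?(ltW dw)//.
  by rewrite !mulr_ge0// ltW.
by rewrite /X in X0; lra.
Qed.

Lemma recovery : exists tau : {perm 'I_K}, forall j, j \in S ->
  [/\ zh j = tau (zstar j), Thh j = Bh (zh j) &
    rho * #|T (zstar j) :&: S|%:R * norm2 (Bh (zh j) - thetastar j) <=
      norm2 (\sum_(k in T (zstar j) :&: S) grad (f k) (thetastar k)) +
      4 * L * delta * #|T (zstar j) :&: S|%:R + lam * #|~: S|%:R].
Proof.
have [tau htau] := centers_matched; exists tau => j jS.
have [zj Tj] := labels_exact tau htau j jS.
by split; last exact: center_dist htau jS.
Qed.

(** Only [Thh j] changes, so the labels stay feasible, and the triangle inequality eliminates the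
    fitted centre. This feeds [tame_prox_dist]. *)
Lemma prox_opt j p : f j (Thh j) <= f j p + lam * norm2 (p - Thh j).
Proof.
pose Th k := if k == j then p else Thh k.
pose h k := if k == j then f j (Thh j) - f j p - lam * norm2 (p - Thh j) else 0.
suff : \sum_(k < m) h k <= 0 by rewrite /h -big_mkcond big_pred1_eq; lra.
apply: (objective_diff Th Bh zh) => // k; rewrite /h /Th /cost.
case: eqP => [->|_]; last by rewrite subrr.
have := ler_wpM2l (ltW lam0) (dist2_triangle (Thh j) (Bh (zh j)) p).
by rewrite (dist2C (Thh j)); lra.
Qed.

End Recovery.

(** * Choice of constants and the two ranges of [delta] *)

Theorem theoremA4 (R : realType) (d m K : nat)
  (f : 'I_m -> 'rV[R]_d -> R) (eps delta : R) (M : \bar R) (rho L : R)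
  (alpha lam : R) (betastar : 'I_K -> 'rV[R]_d) (zstar : 'I_m -> 'I_K)
  (thetastar : 'I_m -> 'rV[R]_d) (S : {set 'I_m})
  (Thh : 'I_m -> 'rV[R]_d) (Bh : 'I_K -> 'rV[R]_d) (zh : 'I_m -> 'I_K) :
  0 <= eps -> 0 <= delta -> (0 < M)%E -> 0 < rho -> rho <= L ->
  (2 <= K)%N -> 0 < alpha -> alpha <= 1 ->
  (forall j, j \in S -> regular (f j) (thetastar j) M rho L) ->
  (forall j, j \notin S -> differentiable (f j) (thetastar j)) ->
  (forall j, j \in S -> norm2 (thetastar j - betastar (zstar j)) <= delta) ->
  #|~: S|%:R <= eps * m%:R ->
  let kappa := L / rho in
  let T := fun k : 'I_K => [set j | zstar j == k] in
  eps <= alpha / (6 * kappa * K%:R ^+ 2) ->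
  (forall k, 7 * alpha * m%:R / (6 * K%:R) <= #|T k|%:R) ->
  (forall j, 12 * kappa * K%:R / Num.sqrt alpha * norm2 (grad (f j) (thetastar j))
               < lam) ->
  ((lam%:E < (rho / 6)%:E * M)%E) ->
  (forall k l : 'I_K, k != l -> lam < rho / 6 * norm2 (betastar k - betastar l)) ->
  feasible alpha zh ->
  (forall (Th : 'I_m -> 'rV[R]_d) (B : 'I_K -> 'rV[R]_d) (z : 'I_m -> 'I_K),
     feasible alpha z ->
     objective f lam Thh Bh zh <= objective f lam Th B z) ->
  (forall j, j \in S ->
     let TS := T (zstar j) :&: S in
     norm2 (Thh j - thetastar j) <=
       norm2 (\sum_(k in TS) grad (f k) (thetastar k)) / (rho * #|TS|%:R)
       + Num.min (55 * kappa ^+ 2 * K%:R * delta / Num.sqrt alpha)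
                 (11 * lam / (5 * rho))
       + lam * #|~: S|%:R / (rho * #|TS|%:R))
  /\
  (delta <= Num.sqrt alpha * lam / (100 * kappa * K%:R * L) ->
   exists tau : {perm 'I_K},
     forall j, j \in S -> zh j = tau (zstar j) /\ Thh j = Bh (zh j)).
Proof.
move=> eps0 de0 M0 rho0 rL K2 a0 a1 hreg _ hde hout kappa T heps hT hgrad hM hsep feas opt.
have L0 : 0 < L := lt_le_trans rho0 rL.
have [m0|m_gt0] := posnP m.
  split=> [j|_]; first by have := ltn_ord j; rewrite [X in (_ < X)%N]m0.
  by exists 1%g => j; have := ltn_ord j; rewrite [X in (_ < X)%N]m0.
have kap1 : 1 <= kappa by rewrite ler_pdivlMr// mul1r.
have kap0 : 0 <= kappa by lra.
have lam0 : 0 < lam.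
  apply: le_lt_trans (hgrad (Ordinal m_gt0)).
  apply: mulr_ge0 (norm2_ge0 _); apply: divr_ge0 (sqrtr_ge0 _).
  by apply: mulr_ge0 (ler0n _ _); apply: mulr_ge0 kap0.
pose k : R := K%:R; have k2 : 2 <= k by rewrite /k (ler_nat R 2 K).
have k0 : 0 < k by lra.
pose sa := Num.sqrt alpha; have sa0 : 0 < sa by rewrite sqrtr_gt0.
have sa2 : sa ^+ 2 = alpha by rewrite sqr_sqrtr// ltW.
have sa1 : sa <= 1 by rewrite -sqrtr1 ler_wsqrtr.
pose v := sa / k.
have v0 : 0 <= v by rewrite divr_ge0// ltW.
have v2 : v <= 1 / 2 by rewrite ler_pdivrMr//; lra.
pose q := alpha * m%:R / k.
have q0 : 0 < q by rewrite divr_gt0// mulr_gt0// ltr0n.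
have [rho_neq0 L_neq0 k_neq0 sa_neq0] : [/\ rho != 0, L != 0, k != 0 & sa != 0].
  by rewrite !gt_eqF.
have vq : v ^+ 2 * m%:R <= q / 2.
  have -> : v ^+ 2 * m%:R = q / k by rewrite /v /q -sa2; field.
  by rewrite ler_pM2l// lef_pV2// posrE.
(* Chosen so that [12 * kappa * K / sqrt alpha * eta = lam]. *)
pose eta := v * rho * lam / (12 * L).
have eta0 : 0 <= eta.
  apply: divr_ge0 (mulr_ge0 _ (ltW L0)) => //.
  exact: mulr_ge0 (mulr_ge0 v0 (ltW rho0)) (ltW lam0).
have eta1 : eta <= lam / 24.
  have -> : eta = v * (rho / L) * (lam / 12) by rewrite /eta; field.
  have w1 : rho / L <= 1 by rewrite ler_pdivrMr// mul1r.
  have := ler_pM v0 (ltW (divr_gt0 rho0 L0)) v2 w1 => h.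
  have l12 : 0 <= lam / 12 by lra.
  by have := ler_wpM2r l12 h; lra.
have geta j : norm2 (grad (f j) (thetastar j)) <= eta.
  have c0 : 0 < 12 * kappa * K%:R / sa.
    by apply: divr_gt0 sa0; apply: mulr_gt0 k0; apply: mulr_gt0 => //; lra.
  rewrite -(ler_pM2l c0).
  have -> : 12 * kappa * K%:R / sa * eta = lam.
    by rewrite /eta /v /kappa -/k; field; rewrite rho_neq0 L_neq0 k_neq0 sa_neq0.
  exact/ltW/hgrad.
have r0 : 0 < 6 * lam / rho by rewrite divr_gt0// mulr_gt0.
have rM : ((6 * lam / rho)%:E <= M)%E.
  case: M M0 hM {hreg} => [M'| |] //=; last by rewrite leey.
  move=> _; rewrite -EFinM lte_fin lee_fin => h.
  by rewrite ler_pdivrMr//; lra.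
have tf j : j \in S -> tame (f j) (thetastar j) (grad (f j) (thetastar j))
    (6 * lam / rho) rho L.
  by move=> jS; apply: regular_tame (hreg j jS) (ltW r0) rM.
(* [K >= 2] turns the factor [6 * K] into [12]. *)
have out : #|~: S|%:R <= q * rho / (12 * L).
  apply: le_trans hout _.
  have := ler_wpM2r (ler0n R m) heps => h; apply: le_trans h _.
  have -> : alpha / (6 * kappa * K%:R ^+ 2) * m%:R = q * rho / (6 * L) / k.
    by rewrite /kappa /q -/k; field; rewrite rho_neq0 L_neq0 k_neq0.
  have -> : q * rho / (12 * L) = q * rho / (6 * L) / 2 by field.
  rewrite ler_pM2l ?lef_pV2 ?posrE//.
  by apply: divr_gt0 (mulr_gt0 q0 rho0) _; apply: mulr_gt0 L0.
have out12 : #|~: S|%:R <= q / 12.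
  apply: le_trans out _; rewrite ler_pdivrMr ?mulr_gt0//.
  by have := ler_wpM2l (ltW q0) rL; lra.
(* [7 / 6 - 1 / 12 = 13 / 12]. *)
have hTS l : 13 / 12 * q <= #|T l :&: S|%:R.
  have := hT l.
  have -> : 7 * alpha * m%:R / (6 * K%:R) = 7 / 6 * q by rewrite /q -/k; field.
  rewrite -(cardsID S (T l)) natrD.
  have : #|T l :\: S|%:R <= #|~: S|%:R :> R.
    by rewrite ler_nat subset_leq_card// finset.setDE finset.subsetIr.
  by move: out12; lra.
have rec := recovery f rho L lam alpha v eta delta betastar zstar thetastar S
  Thh Bh zh rho0 rL lam0 q0 tf (fun j _ => geta j) v0 v2 vq erefl de0 _ hde out
  hTS hsep feas opt.
split=> [j jS|hdel]; last first.
  have [|tau htau] := rec.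
    (* The constant [100] is stricter than the [26] that [recovery] asks for. *)
    apply: le_trans hdel _.
    have -> : v * rho * lam / (26 * L ^+ 2) = 100 / 26 * (sa * lam / (100 * kappa * K%:R * L)).
      by rewrite /v /kappa -/k; field; rewrite rho_neq0 L_neq0 k_neq0.
    rewrite -/sa; apply: ler_peMl; last by rewrite ler_pdivlMr//; lra.
    apply: divr_ge0 (mulr_ge0 (ltW sa0) (ltW lam0)) (mulr_ge0 _ (ltW L0)).
    by apply: mulr_ge0 (ltW k0); apply: mulr_ge0 kap0.
  by exists tau => j /htau[].
cbv zeta; set TS := T (zstar j) :&: S.
have n0 : 0 < #|TS|%:R :> R.
  by apply: lt_le_trans (hTS (zstar j)); lra.
have rn0 : 0 < rho * #|TS|%:R by rewrite mulr_gt0.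
set G := norm2 (\sum_(_ in _) _).
have G0 : 0 <= G / (rho * #|TS|%:R) by rewrite divr_ge0 ?norm2_ge0// ltW.
have S0 : 0 <= lam * #|~: S|%:R / (rho * #|TS|%:R).
  by apply: divr_ge0 (mulr_ge0 (ltW lam0) (ler0n _ _)) (ltW rn0).
have dE : 55 * kappa ^+ 2 * K%:R * delta / sa = 55 * (kappa * (kappa * (delta / v))).
  by rewrite /v -/k; field; rewrite sa_neq0 k_neq0.
have v_gt0 : 0 < v by rewrite divr_gt0.
have lr0 : 0 < lam / rho by rewrite divr_gt0.
have [small|large] := leP delta (v * rho * lam / (26 * L ^+ 2)).
  have [tau /(_ j jS)[_ Tj]] := rec small; rewrite -Tj => h.
  have : norm2 (Thh j - thetastar j) <=
      G / (rho * #|TS|%:R) + 4 * (kappa * delta) + lam * #|~: S|%:R / (rho * #|TS|%:R).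
    rewrite -(ler_pM2l rn0); apply: le_trans h _.
    rewrite le_eqVlt; apply/orP; left; apply/eqP; rewrite /kappa -/TS -/G.
    by field; rewrite rho_neq0 gt_eqF.
  suff : 4 * (kappa * delta) <= Num.min (55 * kappa ^+ 2 * K%:R * delta / sa)
      (11 * lam / (5 * rho)) by rewrite -/sa; lra.
  rewrite le_min dE; apply/andP; split.
    have d1 : delta <= delta / v.
      by rewrite ler_pdivlMr// ler_piMr//; apply: le_trans v2 _; rewrite ler_pdivrMr// mul1r ler1n.
    have d2 := ler_wpM2l kap0 d1.
    have d3 := mulr_ge0 kap0 (divr_ge0 de0 v0).
    have := ler_peMl d3 kap1; lra.
  have h1 := ler_wpM2l kap0 small.
  have e1 : kappa * (v * rho * lam / (26 * L ^+ 2)) = (v / 26) * (lam / L).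
    by rewrite /kappa; field; rewrite rho_neq0 L_neq0.
  have h2 : (v / 26) * (lam / L) <= 1 / 52 * (lam / rho).
    apply: ler_pM; [lra|exact: divr_ge0 (ltW lam0) (ltW L0)|lra|].
    by rewrite ler_pM2l// lef_pV2.
  have -> : 11 * lam / (5 * rho) = 11 / 5 * (lam / rho) by field.
  by lra.
(* Large [delta]: the prox bound is [25 / 12 * (lam / rho)]. It lies below [11 / 5 * (lam / rho)],
   and below [55 / 26 * (lam / rho)], which the lower bound on [delta] puts under the other term of
   the minimum. *)
have h1 : norm2 (Thh j - thetastar j) <= 2 * (lam + eta) / rho.
  apply: (tame_prox_dist _ _ _ _ _ _ _ (tf j jS)) => //.
    have -> : rho * (6 * lam / rho) / 2 = 3 * lam by field.
    by lra.
  exact: (prox_opt f lam alpha Thh Bh zh lam0 feas opt).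
have h2 : 2 * (lam + eta) / rho <= 25 / 12 * (lam / rho).
  have -> : 25 / 12 * (lam / rho) = (25 / 12 * lam) / rho by field.
  by rewrite ler_pM2r ?invr_gt0//; lra.
suff : 25 / 12 * (lam / rho) <= Num.min (55 * kappa ^+ 2 * K%:R * delta / sa)
    (11 * lam / (5 * rho)) by rewrite -/sa; lra.
rewrite le_min dE; apply/andP; split; last first.
  have -> : 11 * lam / (5 * rho) = 11 / 5 * (lam / rho) by field.
  by lra.
have : lam / rho / 26 <= kappa * (kappa * (delta / v)).
  have -> : lam / rho / 26 = kappa * (kappa * (v * rho * lam / (26 * L ^+ 2) / v)).
    by rewrite /kappa; field; rewrite rho_neq0 L_neq0 gt_eqF.
  rewrite !ler_wpM2l// ler_pM2r ?invr_gt0//; exact: ltW.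
by lra.
Qed.
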